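(* Let $G$ be a finite undirected graph on $n$ vertices, possibly with loops, with adjacency matrix $A\in\{0,1\}^{n\times n}$, and let $W=[e,\,Ae,\,\ldots,\,A^{n-1}e]\in\mathbb{Z}^{n\times n}$ be its walk matrix, where $e=(1,\ldots,1)^{\mathsf T}\in\mathbb{Z}^n$. Suppose that $\det(W)$ is square-free. Then $G$ is characterized by its $\mathbb{R}$-spectrum; that is, every finite undirected graph $H$, possibly with loops, satisfying $\varphi_G(\lambda,t)=\varphi_H(\lambda,t)$ for all $\lambda,t\in\mathbb{R}$ is isomorphic to $G$.
   Context: Graphs are finite and undirected, and may include self-loops (no multiple edges). The adjacency matrix $A$ of a graph is the symmetric $\{0,1\}$-matrix with $A_{ij}=1$ if and only if $i$ and $j$ are adjacent; a loop at vertex $i$ corresponds to $A_{ii}=1$. For a graph $G$ with adjacency matrix $A$, define $\varphi_G(\lambda,t)=\det(\lambda I-A-tJ)$, where $I$ is the identity matrix and $J$ is the all-ones matrix. An integer $M\in\mathbb{Z}$ is square-free if there is no prime $p$ with $p^2\mid M$ (in particular $0$ is not square-free). *)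

(* Defs.v *)
From mathcomp Require Import all_boot all_order all_algebra.
From mathcomp Require Import reals.

Set Implicit Arguments.
Unset Strict Implicit.
Unset Printing Implicit Defensive.

Import GRing.Theory.
Local Open Scope ring_scope.

(* [adj] is symmetric but not required to be irreflexive: loops are allowed. *)
Record loopgraph (n : nat) := LoopGraph {
  adj : rel 'I_n;
  adj_sym : symmetric adj
}.

Definition adjmx (R : pzSemiRingType) (n : nat) (G : loopgraph n) : 'M[R]_n :=
  \matrix_(i, j) (adj G i j)%:R.

Definition walkmx (n : nat) (G : loopgraph n) : 'M[int]_n :=
  \matrix_(i, j) (adjmx int G ^+ j *m (const_mx 1 : 'cV[int]_n)) i 0.

Definition phi (R : comPzRingType) (n : nat) (G : loopgraph n) (lambda t : R) : R :=
  \det (lambda%:M - adjmx R G - t *: const_mx 1).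

Definition squarefreez (M : int) : Prop :=
  forall p : nat, prime p -> ~~ ((p ^ 2)%N %| M)%Z.

Definition isomorphic (n m : nat) (G : loopgraph n) (H : loopgraph m) : Prop :=
  exists2 f : 'I_n -> 'I_m, bijective f
    & forall i j : 'I_n, adj H (f i) (f j) = adj G i j.

(* Main.v *)
(* The equality of [phi G] and [phi H] says that A and B have the same characteristic
   polynomial and the same walk counts e^T A^k e, so the walk matrices W and V satisfy
   W^T W = V^T V, A W = W C and B V = V C for one companion matrix C.  Hence
   P = W V^-1 is orthogonal, P e = e and A P = P B, and P is a permutation matrix as
   soon as it is integral.  Since det V is square-free, integrality amounts to
   ker V <= ker W mod p for every prime p dividing det V.  Both kernels are C-stable
   lines.  If they were distinct, symmetry of A would force C to act on both by the
   same scalar, whereas the eigenspaces of a companion matrix are at most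
   one-dimensional.  The argument is uniform in p, including p = 2. *)

Require Import Defs.
From mathcomp Require Import all_boot all_order all_algebra.
From mathcomp Require Import reals.

Set Implicit Arguments.
Unset Strict Implicit.
Unset Printing Implicit Defensive.

Import Order.TTheory GRing.Theory Num.Theory.
Local Open Scope ring_scope.

(** * Rank-one perturbations and walk counts *)

(** One factorization gives the bordered matrix [L] the determinant [\det (M + u *m v)]; clearing
    its lower-left block with [\adj M] gives the right side up to a factor [\det M], which is
    cancelled. *)
Lemma det_rank1_update (R : idomainType) n (M : 'M[R]_n) (u : 'cV_n) (v : 'rV_n) :
  \det M != 0 -> \det (M + u *m v) = \det M + (v *m \adj M *m u) 0 0.
Proof.
move=> nzd; set d := \det M.
pose L : 'M_(1 + n) := block_mx 1%:M (- v) u M.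
have detL : \det L = \det (M + u *m v).
  have -> : L = block_mx 1%:M 0 u 1%:M *m block_mx 1%:M (- v) 0 (M + u *m v).
    rewrite mulmx_block !mulmx1 !mul1mx !mul0mx !addr0 mulmxN.
    by rewrite addrC addrK.
  by rewrite det_mulmx det_lblock det_ublock !det1 !mul1r.
apply/(mulfI nzd); rewrite mulrC -{1}detL.
have: L *m block_mx d%:M 0 (- (\adj M *m u)) 1%:M =
      block_mx (d + (v *m \adj M *m u) 0 0)%:M (- v) 0 M.
  rewrite mulmx_block !mulmx1 ?mul1mx ?mulmx0 ?add0r mulNmx !mulmxN opprK !mulmxA.
  rewrite mul_mx_adj mul_mx_scalar mul_scalar_mx subrr raddfD /=.
  by rewrite -mx11_scalar.
move/(congr1 determinant); rewrite det_mulmx det_lblock det_ublock !det1 mulr1 !det_scalar1.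
by rewrite mulrC [RHS]mulrC mulrC.
Qed.

(** Each cofactor is, up to sign, a determinant of order [n - 1] with entries of degree at most
    one. *)
Lemma size_char_poly_adj (R : comNzRingType) n (A : 'M[R]_n) i j :
  (size (\adj (char_poly_mx A) i j) <= n)%N.
Proof.
rewrite mxE /cofactor; case: n A i j => [|n] A i j; first by case: i.
rewrite -signr_odd mulr_sign.
set D := \det _; suff: (size D <= n.+1)%N by case: ifP => // _; rewrite size_polyN.
rewrite {}/D /determinant; apply: (leq_trans (size_sum _ _ _)); apply/bigmax_leqP=> s _.
rewrite -signr_odd mulr_sign.
set D := \prod_i _; suff: (size D <= n.+1)%N by case: ifP => // _; rewrite size_polyN.
apply: (leq_trans (size_poly_prod_leq _ _)).
rewrite leq_subLR cardT size_enum_ord addnS ltnS.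
have -> : (n + n = \sum_(k : 'I_n) 2)%N.
  by rewrite sum_nat_const cardT size_enum_ord muln2 addnn.
apply: leq_sum => k _; rewrite !mxE.
apply: leq_trans (size_polyD _ _) _; rewrite size_polyN geq_max.
rewrite size_polyC (leq_trans (leq_b1 _)) // andbT.
by case: (_ == _); rewrite ?mulr1n ?mulr0n ?size_polyX ?size_poly0.
Qed.

(* With g_k = v adj(X - A) A^k u one has X g_k - g_(k+1) = (v A^k u) char_poly A; as
   deg g_k < n, the polynomial g_k determines both v A^k u and g_(k+1). *)
Lemma walk_counts_eq (R : idomainType) n (A B : 'M[R]_n) (u : 'cV_n) (v : 'rV_n) :
  char_poly A = char_poly B -> char_poly (A - u *m v) = char_poly (B - u *m v) ->
  forall k, v *m iter k (mulmx A) u = v *m iter k (mulmx B) u.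
Proof.
move=> eqAB eqABuv.
pose g (M : 'M[R]_n) k : {poly R} :=
  (map_mx polyC v *m \adj (char_poly_mx M) *m map_mx polyC (iter k (mulmx M) u)) 0 0.
have size_g M k : (size (g M k) <= n)%N.
  rewrite /g !mxE; apply: leq_trans (size_sum _ _ _) _; apply/bigmax_leqP => i _.
  rewrite [map_mx polyC _ i 0]mxE mulrC mul_polyC; apply: leq_trans (size_scale_leq _ _) _.
  rewrite mxE; apply: leq_trans (size_sum _ _ _) _; apply/bigmax_leqP => j _.
  rewrite [map_mx polyC v 0 j]mxE mul_polyC; apply: leq_trans (size_scale_leq _ _) _.
  exact: size_char_poly_adj.
have gS M k : 'X * g M k - g M k.+1 = (v *m iter k (mulmx M) u) 0 0 *: char_poly M.
  set w := iter k _ u.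
  have -> : (v *m w) 0 0 *: char_poly M =
      (map_mx polyC v *m \adj (char_poly_mx M) *m (char_poly_mx M *m map_mx polyC w)) 0 0.
    rewrite mulmxA -(mulmxA (map_mx polyC v)) mul_adj_mx mul_mx_scalar -scalemxAl -map_mxM.
    by rewrite !mxE mulrC mul_polyC.
  rewrite {2}/char_poly_mx mulmxBl mul_scalar_mx -map_mxM mulmxBr -scalemxAr.
  by rewrite /g !mxE.
(* [det_rank1_update] applies over polynomials because the monic [char_poly M] is nonzero. *)
have g0 M : char_poly (M - u *m v) = char_poly M + g M 0%N.
  rewrite {1}/char_poly /char_poly_mx map_mxB map_mxM opprB addrCA addrC.
  rewrite det_rank1_update //; exact: monic_neq0 (char_poly_monic M).
have eqg k : g A k = g B k /\ (v *m iter k (mulmx A) u) = (v *m iter k (mulmx B) u).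
  elim: k => [|k [eqgk _]].
    by split=> //; move: eqABuv; rewrite !g0 eqAB => /addrI.
  pose dw k := (v *m iter k (mulmx A) u) 0 0 - (v *m iter k (mulmx B) u) 0 0.
  have step j : g A j = g B j -> g A j.+1 = g B j.+1 /\ dw j = 0.
    move=> e; have:= gS B j; rewrite -e -eqAB => eB; have eA := gS A j.
    have e2 : g B j.+1 - g A j.+1 = dw j *: char_poly A.
      by rewrite scalerBl -eA -eB opprB [RHS]addrC addrA subrK.
    have dw0 : dw j = 0.
      apply: contraTeq (size_g A 0%N) => nz; exfalso.
      have : (size (dw j *: char_poly A) <= n)%N.
        rewrite -e2 (leq_trans (size_polyD _ _)) // size_polyN geq_max !size_g //.
      by rewrite -mul_polyC size_Cmul // size_char_poly ltnn.
    split=> //; apply/esym/eqP; rewrite -subr_eq0 e2 dw0 scale0r //.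
  have [eS _] := step _ eqgk; have [_ e0] := step _ eS.
  split=> //; apply/matrixP=> i j; rewrite !ord1; exact: subr0_eq.
by move=> k; have [] := eqg k.
Qed.

(** * Kernels of matrices with nonzero adjugate *)

(** A nonzero cofactor exhibits an invertible submatrix of order [n.-1]. *)
Lemma adj_neq0_rank (F : fieldType) n (M : 'M[F]_n) : \adj M != 0 -> (n.-1 <= \rank M)%N.
Proof.
apply: contraNT; rewrite -ltnNge => ltr; apply/eqP/matrixP=> i j; rewrite !mxE /cofactor.
rewrite (_ : \det _ = 0) ?mulr0 //; apply/eqP; apply: contraTT ltr => nzd; rewrite -leqNgt.
set N := row' j (col' i M) in nzd.
have rN : \rank N = n.-1 by apply/mxrank_unit; rewrite unitmxE unitfE.
have lerow m1 m2 (X : 'M[F]_(m1, m2)) k : (\rank (row' k X) <= \rank X)%N.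
  by rewrite mxrankS // row'Esub rowsub_sub.
rewrite -rN (leq_trans (lerow _ _ _ _)) // -mxrank_tr tr_col' -(mxrank_tr M).
exact: lerow.
Qed.

Lemma adj_neq0_ker (F : fieldType) n (M : 'M[F]_n) (x y : 'rV_n) :
  \adj M != 0 -> x *m M = 0 -> y *m M = 0 -> x != 0 -> exists c, y = c *: x.
Proof.
move=> /adj_neq0_rank rM /sub_kermxP xM /sub_kermxP yM nzx; apply/sub_rVP.
apply: submx_trans yM _; have := mxrank_leqif_sup xM => <-.
rewrite eqn_leq mxrankS //= mxrank_ker rank_rV nzx leq_subLR addn1.
by apply: leq_trans (leqSpred _) _.
Qed.

Lemma adj_neq0_kerC (F : fieldType) n (M : 'M[F]_n) (x y : 'cV_n) :
  \adj M != 0 -> M *m x = 0 -> M *m y = 0 -> x != 0 -> exists c, y = c *: x.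
Proof.
move=> nzM Mx My nzx.
have [||||c e] := @adj_neq0_ker F n M^T x^T y^T.
- by rewrite -trmx_adj trmx_eq0.
- by rewrite -trmx_mul Mx trmx0.
- by rewrite -trmx_mul My trmx0.
- by rewrite trmx_eq0.
by exists c; apply: trmx_inj; rewrite e linearZ.
Qed.

(** * Walk matrices modulo a prime *)

Section ReductionModp.

Variables (p : nat) (p_pr : prime p).

Local Notation "M ^p" := (map_mx (intr : int -> 'F_p) M) (at level 2, format "M ^p").

Lemma dvdz_Fp (z : int) : (p %| z)%Z = (z%:~R == 0 :> 'F_p).
Proof. exact/dvdz_pcharf/pchar_Fp. Qed.

Lemma liftFp_mx m n (M : 'M['F_p]_(m, n)) : exists N : 'M[int]_(m, n), N^p = M.
Proof.
exists (\matrix_(i, j) (M i j : nat)%:Z); apply/matrixP=> i j; rewrite !mxE.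
exact: natr_Zp.
Qed.

Lemma reduceFp_eq0 m n (M : 'M[int]_(m, n)) :
  M^p = 0 -> exists N : 'M[int]_(m, n), M = p%:Z *: N.
Proof.
move=> M0; exists (\matrix_(i, j) (M i j %/ p)%Z); apply/matrixP=> i j.
by rewrite !mxE mulrC divzK // dvdz_Fp; move/matrixP/(_ i j): M0; rewrite !mxE => ->.
Qed.

(* Applying [\adj W] to [W x = p m] gives [\adj W m = (det W / p) x]. *)
Lemma adj_mul_neq0 n (W : 'M[int]_n) (x m : 'cV_n) :
  ~~ ((p ^ 2)%N %| \det W)%Z -> x^p != 0 -> W *m x = p%:Z *: m ->
  \adj (W^p) *m m^p != 0.
Proof.
move=> sqf nzx Wx.
have pz : p%:Z != 0 by rewrite eqz_nat -lt0n prime_gt0.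
have e : p%:Z *: (\adj W *m m) = \det W *: x.
  by rewrite scalemxAr -Wx mulmxA mul_adj_mx mul_scalar_mx.
(* Otherwise reducing [e] modulo [p] would make [x] vanish. *)
have /dvdzP[q dW] : (p %| \det W)%Z.
  rewrite dvdz_Fp; apply: contraNT nzx => nzd; apply/eqP.
  have := congr1 (fun X : 'cV[int]_n => X^p) e; rewrite !map_mxZ /=.
  rewrite (_ : p%:~R = 0) ?scale0r; last by apply/eqP; rewrite -dvdz_Fp.
  by move/esym/eqP; rewrite scalemx_eq0 (negPf nzd) => /eqP.
have {}e : \adj W *m m = q *: x.
  apply/matrixP=> i j; apply: (mulfI pz); move: (\adj W *m m) e => am /matrixP/(_ i j).
  by rewrite dW !mxE => ->; rewrite mulrCA mulrA.
rewrite -map_mx_adj -map_mxM e map_mxZ scalemx_eq0 negb_or nzx andbT -dvdz_Fp.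
by apply: contraNN sqf => /dvdzP[r qr];
  apply/dvdzP; exists r; rewrite dW qr -mulrA -PoszM mulnn.
Qed.

(* Let x and y span the kernels of W and V, and suppose W y <> 0 mod p.  Writing W x = p m,
   the number (W y)^T m is nonzero mod p and, A being symmetric, is multiplied by both
   eigenvalues of C under insertion of A; so x and y would be independent eigenvectors
   of C for one eigenvalue, contradicting [Csimple]. *)
Lemma walk_kernel_sub n (A W V C : 'M[int]_n.+1) :
    A^T = A -> A *m W = W *m C -> (exists B, B *m V = V *m C) ->
    W^T *m W = V^T *m V ->
    (forall (a : 'F_p) (z : 'cV_n.+1), C^p *m z = a *: z -> z ord_max 0 = 0 -> z = 0) ->
    ~~ ((p ^ 2)%N %| \det W)%Z -> ~~ ((p ^ 2)%N %| \det V)%Z ->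
  forall y : 'cV_n.+1, V^p *m y = 0 -> W^p *m y = 0.
Proof.
move=> symA AW [B BV] WV Csimple sqfW sqfV y Vy; apply/eqP/negPn/negP => Wy.
have nzy : y != 0 by apply: contraNneq Wy => ->; rewrite mulmx0.
have AWp : A^p *m W^p = W^p *m C^p by rewrite -!map_mxM AW.
have BVp : B^p *m V^p = V^p *m C^p by rewrite -!map_mxM BV.
have WVp : W^p^T *m W^p = V^p^T *m V^p by rewrite !map_trmx -!map_mxM WV.
have detWp0 : \det W^p = 0.
  have detV : \det V^p = 0.
    apply/eqP; apply: contraNT nzy => nzd.
    have uV : V^p \in unitmx by rewrite unitmxE unitfE.
    by rewrite -[y](mulKmx uV) Vy mulmx0.
  have/eqP := congr1 determinant WVp; rewrite !det_mulmx !det_tr detV mulr0 mulf_eq0 orbb.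
  by move/eqP.
have [x nzx Wx] : exists2 x : 'cV_n.+1, x != 0 & W^p *m x = 0.
  have/det0P[u nzu uW] : \det W^p^T == 0 by rewrite det_tr detWp0.
  exists u^T; first by rewrite trmx_eq0.
  by apply: trmx_inj; rewrite trmx_mul trmxK uW trmx0.
have lift_ker (M : 'M[int]_n.+1) (u : 'cV['F_p]_n.+1) : M^p *m u = 0 ->
    exists u' m : 'cV[int]_n.+1, u'^p = u /\ M *m u' = p%:Z *: m.
  have [u' <-] := liftFp_mx u; rewrite -map_mxM => /reduceFp_eq0[m e].
  by exists u', m.
(* A nonzero kernel vector forces a nonzero adjugate, so the kernels of [W] and [V] modulo [p] are
   lines. *)
have adj_neq0 (M : 'M[int]_n.+1) (u : 'cV['F_p]_n.+1) :
    ~~ ((p ^ 2)%N %| \det M)%Z -> M^p *m u = 0 -> u != 0 -> \adj M^p != 0.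
  move=> sqfM /lift_ker[u' [m [<- e]]] nzu.
  by apply: contraNneq (adj_mul_neq0 sqfM nzu e) => ->; rewrite mul0mx.
have nzadjW := adj_neq0 _ _ sqfW Wx nzx; have nzadjV := adj_neq0 _ _ sqfV Vy nzy.
(* Modulo [p], [W C x = A W x = 0]: the kernel line is stable under [C], so [x] is an eigenvector.
   The same holds for [y] and [V]. *)
have [a Cx] : exists a, C^p *m x = a *: x.
  by apply: (adj_neq0_kerC nzadjW) => //; rewrite mulmxA -AWp -mulmxA Wx mulmx0.
have [b Cy] : exists b, C^p *m y = b *: y.
  by apply: (adj_neq0_kerC nzadjV) => //; rewrite mulmxA -BVp -mulmxA Vy mulmx0.
have [x' [m [xx' Wx']]] := lift_ker _ _ Wx.
(* Lift [C x = a x] to [C x' = a' x' + p z], apply [W], and divide by [p] using [W x' = p m]. *)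
have [z Am] : exists z, A^p *m m^p = a *: m^p + W^p *m z.
  have [a' aa'] := liftFp_mx (a%:M : 'M_1).
  have {}aa' : (a' 0 0)%:~R = a by move/matrixP/(_ 0 0): aa'; rewrite !mxE mulr1n.
  have : (C *m x' - a' 0 0 *: x')^p = 0.
    by rewrite map_mxB map_mxM map_mxZ xx' /= aa' Cx subrr.
  case/reduceFp_eq0 => z ez; exists z^p.
  rewrite -[a]aa' -!map_mxM -map_mxZ -map_mxD; congr (_^p).
  apply/matrixP=> i j; apply: (mulfI (x := p%:Z)).
    by rewrite eqz_nat -lt0n prime_gt0.
  suff : p%:Z *: (A *m m) = p%:Z *: (a' 0 0 *: m + W *m z).
    by move/matrixP/(_ i j); rewrite mxE [RHS]mxE.
  rewrite scalerDr scalerA mulrC -scalerA -Wx' !scalemxAr -ez -Wx' mulmxA AW.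
  by rewrite -mulmxA mulmxBr -scalemxAr addrC subrK.
set u := (W^p *m y)^T.
have uW : u *m W^p = 0.
  by rewrite /u trmx_mul -mulmxA WVp mulmxA -trmx_mul Vy trmx0 mul0mx.
(* The rows of [\adj W] lie in the left kernel of [W] modulo [p], the line spanned by [u]; hence
   [u m = 0] would give [\adj W m = 0]. *)
have nzum : u *m m^p != 0.
  have nzu : u != 0 by rewrite trmx_eq0.
  rewrite -xx' in nzx.
  apply: contraNneq (adj_mul_neq0 sqfW nzx Wx') => um; apply/eqP/row_matrixP=> i.
  have [|c ec] := @adj_neq0_ker _ _ W^p u (row i (\adj W^p)) nzadjW uW _ nzu.
    by rewrite -row_mul mul_adj_mx detWp0 -scalemx1 scale0r row0.
  by rewrite row_mul ec -scalemxAl um scaler0 row0.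
have ab : a = b.
  apply/eqP; rewrite -subr_eq0.
  have : (a - b) *: (u *m m^p) == 0.
    rewrite scalerBl subr_eq0; apply/eqP.
    transitivity (u *m A^p *m m^p).
      by rewrite -mulmxA Am mulmxDr -scalemxAr mulmxA uW mul0mx addr0.
    have -> : u *m A^p = b *: u.
      rewrite -{1}symA -map_trmx -trmx_mul mulmxA AWp -mulmxA Cy -scalemxAr.
      by rewrite linearZ.
    by rewrite -scalemxAl.
  by rewrite scalemx_eq0 (negPf nzum) orbF.
have nzxl : x ord_max 0 != 0 by apply: contraNneq nzx => /(Csimple _ _ Cx) ->.
(* The coefficients make the last coordinate vanish, so [Csimple] kills this vector; applying [W]
   then leaves a nonzero multiple of [W y]. *)
have : x ord_max 0 *: y - y ord_max 0 *: x = 0.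
  apply: (Csimple a); last by rewrite !mxE mulrC subrr.
  by rewrite mulmxBr -!scalemxAr Cx Cy -ab scalerBr !scalerA ![a * _]mulrC.
move/(congr1 (mulmx W^p))/eqP; rewrite mulmxBr -!scalemxAr Wx scaler0 subr0 mulmx0.
by rewrite scalemx_eq0 (negPf nzxl) (negPf Wy).
Qed.

End ReductionModp.

(** * Square-free divisors and integral orthogonal matrices *)

(** Every prime has exponent at most one in [d], so the prime-power parts of [d] are primes or 1. *)
Lemma dvdz_squarefree (d z : int) : squarefreez d ->
  (forall p : nat, prime p -> (p %| d)%Z -> (p %| z)%Z) -> (d %| z)%Z.
Proof.
move=> sqf dvdp; have d_gt0 : (0 < `|d|)%N.
  (* Zero is excluded, being divisible by [2 ^ 2]. *)
  by rewrite lt0n absz_eq0; apply: contraTneq (sqf 2%N isT) => ->; rewrite dvdz0.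
apply/(dvdn_partP _ d_gt0) => p; rewrite mem_primes => /and3P[p_pr _ pd].
rewrite p_part; apply: dvdn_trans (dvdn_exp2l p _) (dvdp p p_pr pd : (p ^ 1 %| _)%N).
by rewrite -ltnS ltnNge -pfactor_dvdn //; exact: sqf.
Qed.

(** In each row the entries and their squares both sum to 1, so the terms [z * (z - 1)], nonnegative
    on integers, sum to zero and every entry is 0 or 1. Orthogonality of distinct rows makes [f]
    injective. *)
Lemma int_orthogonal_perm n (P : 'M[int]_n) :
  P *m P^T = 1%:M -> P *m (const_mx 1 : 'cV_n) = const_mx 1 ->
  exists f : 'I_n -> 'I_n, injective f /\ P = \matrix_(i, j) (j == f i)%:R.
Proof.
move=> PPt Pe.
have sum1 i : \sum_j P i j = 1.
  have/matrixP/(_ i 0) := Pe; rewrite !mxE => <-.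
  by apply: eq_bigr => j _; rewrite mxE mulr1.
have sum2 i : \sum_j P i j * P i j = 1.
  have/matrixP/(_ i i) := PPt; rewrite !mxE eqxx mulr1n => <-.
  by apply: eq_bigr => j _; rewrite mxE.
have P01 i j : P i j = 0 \/ P i j = 1.
  have ge0 (z : int) : 0 <= z * (z - 1).
    have [z0|z0] := lerP z 0; first by rewrite mulr_le0 // subr_le0 (le_trans z0).
    by rewrite mulr_ge0 ?subr_ge0 -?gtz0_ge1 // ltW.
  have : \sum_j P i j * (P i j - 1) = 0.
    by under eq_bigr do rewrite mulrBr mulr1; rewrite sumrB sum1 sum2 subrr.
  move/psumr_eq0P => /(_ (fun j _ => ge0 (P i j))) /(_ j isT) /eqP.
  by rewrite mulf_eq0 subr_eq0 => /orP[]/eqP; [left|right].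
have ex i : exists j, P i j == 1.
  apply/existsP; apply: contraPT (sum1 i) => /existsPn noP.
  rewrite big1 // => j _; have [//|e] := P01 i j.
  by have := noP j; rewrite e.
pose f i := xchoose (ex i).
have Pf i : P i (f i) = 1 by apply/eqP/(xchooseP (ex i)).
have PE i j : P i j = (j == f i)%:R.
  have [->|nj] := eqVneq j (f i); first exact: Pf.
  have := sum1 i; rewrite (bigD1 (f i)) //= Pf -[X in _ = X]addr0 => /addrI.
  by move/psumr_eq0P => -> // k _; case: (P01 i k) => ->.
exists f; split; last by apply/matrixP=> i j; rewrite PE mxE.
move=> i i' eqf; apply/eqP; have/matrixP/(_ i i') := PPt.
rewrite !mxE (bigD1 (f i)) //= mxE Pf eqf Pf mulr1 big1 ?addr0 => [|j nj]; last first.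
  by rewrite PE eqf (negPf nj) mul0r.
by case: (i == i').
Qed.

(** * Companion matrices *)

(** For monic [q] of degree [n.+1], this is multiplication by ['X] modulo [q] in the basis of powers
    of ['X]. *)
Definition companion (R : nzRingType) n (q : {poly R}) : 'M[R]_n.+1 :=
  \matrix_(i, j) if (j < n)%N then (i == j.+1 :> nat)%:R else - q`_i.

Lemma mul_mx_companion (R : nzRingType) m n (q : {poly R}) (W : 'M[R]_(m, n.+1)) i j :
  (W *m companion n q) i j =
    if (j < n)%N then W i (inord j.+1) else - \sum_(k < n.+1) W i k * q`_k.
Proof.
rewrite mxE; case: ifP => ltj; last first.
  by rewrite -sumrN; apply: eq_bigr => k _; rewrite mxE ltj mulrN.
rewrite (bigD1 (inord j.+1)) //= mxE ltj inordK // eqxx mulr1 big1 ?addr0 // => k nk.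
rewrite mxE ltj; case: eqP => [e|]; last by rewrite mulr0.
by case/eqP: nk; apply/val_inj; rewrite /= inordK.
Qed.

(** Once the last coordinate is zero, row [i+1] reads [z_i = a z_(i+1)], so zeros propagate from the
    last coordinate to the first. *)
Lemma companion_eigenvector_eq0 (R : nzRingType) n (q : {poly R}) (a : R) (z : 'cV_n.+1) :
  companion n q *m z = a *: z -> z ord_max 0 = 0 -> z = 0.
Proof.
move=> Cz zmax.
have zE k : (k <= n)%N -> z (inord (n - k)) 0 = 0.
  elim: k => [|k IH] ltk.
    by rewrite subn0 -[RHS]zmax; congr (z _ _); apply/val_inj; rewrite /= inordK.
  have/matrixP/(_ (inord (n - k)) 0) := Cz; rewrite [RHS]mxE IH ?mulr0 1?ltnW // mxE.
  have ltnk : (n - k.+1 < n)%N by rewrite ltn_subrL (leq_trans _ ltk).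
  rewrite big_ord_recr /= zmax mulr0 addr0.
  rewrite (bigD1 (Ordinal ltnk)) //= big1 ?addr0.
    rewrite mxE /= ltnk inordK; last by rewrite ltnS leq_subr.
    rewrite -subSn // subSS eqxx mul1r => <-; congr (z _ _).
    by apply/val_inj; rewrite /= inordK // ltnW.
  move=> j nj; rewrite mxE /= ltn_ord inordK; last by rewrite ltnS leq_subr.
  case: eqP => [e|]; last by rewrite mul0r.
  case/eqP: nj; apply/val_inj; rewrite /= subnS e //.
apply/matrixP=> i j; rewrite ord1 mxE -(zE (n - i)%N) ?leq_subr //.
by congr (z _ _); apply/val_inj; rewrite /= subKn ?inordK // -ltnS.
Qed.

Lemma map_companion (R S : nzRingType) (f : {rmorphism R -> S}) n (q : {poly R}) :
  map_mx f (companion n q) = companion n (map_poly f q).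
Proof.
by apply/matrixP=> i j; rewrite !mxE coef_map; case: ifP => _; rewrite ?rmorph_nat ?rmorphN.
Qed.

(** * Adjacency and walk matrices *)

Lemma adjmx_tr (R : pzSemiRingType) n (G : loopgraph n) : (adjmx R G)^T = adjmx R G.
Proof. by apply/matrixP=> i j; rewrite !mxE adj_sym. Qed.

Lemma map_adjmx (R : pzRingType) n (G : loopgraph n) :
  map_mx intr (adjmx int G) = adjmx R G.
Proof. by apply/matrixP=> i j; rewrite !mxE; case: (adj G i j). Qed.

(** Column [j] of both sides is [A ^+ j.+1 *m e]: by a shift of columns for [j < n], by
    Cayley-Hamilton for [j = n]. *)
Lemma adjmx_walkmx n (G : loopgraph n.+1) :
  adjmx int G *m walkmx G = walkmx G *m companion n (char_poly (adjmx int G)).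
Proof.
set A := adjmx int G; set e := const_mx 1 : 'cV[int]_n.+1.
have AW i j : (A *m walkmx G) i j = (A ^+ j.+1 *m e) i 0.
  by rewrite exprS -mulmxA !mxE; apply: eq_bigr => k _; rewrite !mxE.
apply/matrixP=> i j; rewrite AW mul_mx_companion; case: ltnP => [ltj|lej].
  by rewrite [RHS]mxE inordK.
have -> : j = n :> nat by apply/eqP; rewrite eqn_leq lej -ltnS ltn_ord.
have An : A ^+ n.+1 = - \sum_(k < n.+1) (char_poly A)`_k *: A ^+ k.
  have := Cayley_Hamilton A.
  have /monicP := char_poly_monic A; rewrite lead_coefE size_char_poly /=.
  have := size_char_poly A; move: (char_poly A) => q sq lq.
  rewrite -[q in horner_mx _ q]coefK poly_def sq linear_sum big_ord_recr /=.
  rewrite linearZ /= rmorphXn /= horner_mx_X lq scale1r addrC => /eqP.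
  rewrite addr_eq0 => /eqP->; congr (- _); apply: eq_bigr => k _.
  by rewrite linearZ /= rmorphXn /= horner_mx_X.
rewrite An mulNmx mxE mulmx_suml summxE; congr (- _); apply: eq_bigr => k _.
by rewrite -scalemxAl mxE mulrC [walkmx G i k]mxE.
Qed.

Lemma adjmx_exp_tr (R : comPzRingType) n (G : loopgraph n) k :
  (adjmx R G ^+ k)^T = adjmx R G ^+ k.
Proof.
elim: k => [|k IH]; first by rewrite expr0 trmx1.
by rewrite {1}exprS trmx_mul IH adjmx_tr exprSr.
Qed.

(** Symmetry merges the two powers of the adjacency matrix, so the Gram matrix depends only on walk
    counts. *)
Lemma walkmx_gram n (G : loopgraph n) :
  (walkmx G)^T *m walkmx G =
  \matrix_(i, j) ((const_mx 1 : 'rV_n) *m adjmx int G ^+ (i + j) *m (const_mx 1 : 'cV_n)) 0 0.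
Proof.
apply/matrixP=> i j; rewrite [RHS]mxE exprD mulmxA -mulmxA.
rewrite -(adjmx_exp_tr _ _ i) -(trmx_const _ _ 1) -trmx_mul !mxE.
by apply: eq_bigr => k _; rewrite !mxE.
Qed.

(** * Consequences of equal [phi] *)

Lemma horner_char_poly (R : comNzRingType) n (A : 'M[R]_n) x :
  (char_poly A).[x] = \det (x%:M - A).
Proof.
rewrite -horner_evalE -det_map_mx; congr (\det _); apply/matrixP=> i j.
by rewrite !mxE /= /horner_eval hornerD hornerN hornerMn hornerX hornerC.
Qed.

(** The natural numbers are distinct in [R] and supply more roots of [p - q] than its degree
    allows. *)
Lemma eq_poly_horner (R : numDomainType) (p q : {poly R}) : (forall x, p.[x] = q.[x]) -> p = q.
Proof.
move=> eqpq; apply/eqP; rewrite -subr_eq0; apply/negPn/negP => nz.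
have := @max_poly_roots _ _ [seq k%:R | k <- iota 0 (size (p - q))] nz.
rewrite size_map size_iota ltnn => H; suff: false by []; apply: H.
  by apply/allP=> x _; rewrite rootE !hornerE eqpq subrr.
by rewrite map_inj_uniq ?iota_uniq //; exact/mulrIn/oner_neq0.
Qed.

Lemma phiE (R : comNzRingType) n (G : loopgraph n) (x t : R) :
  phi G x t = (char_poly (adjmx R G + t *: const_mx 1)).[x].
Proof. by rewrite horner_char_poly opprD addrA. Qed.

Lemma phi_eq_size (R : numDomainType) n m (G : loopgraph n) (H : loopgraph m) :
  (forall x t : R, phi G x t = phi H x t) -> n = m.
Proof.
move=> eqphi; apply: succn_inj.
rewrite -(size_char_poly (adjmx R G + 0 *: const_mx 1)).
rewrite -(size_char_poly (adjmx R H + 0 *: const_mx 1)).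
by congr (size (polyseq _)); apply: eq_poly_horner => x; rewrite -!phiE eqphi.
Qed.

Lemma phi_eq_char_poly (R : numDomainType) n (G H : loopgraph n) :
  (forall x t : R, phi G x t = phi H x t) ->
  char_poly (adjmx int G) = char_poly (adjmx int H).
Proof.
move=> eqphi; apply: (map_inj_poly (f := intr : int -> R)) => //; first exact: intr_inj.
rewrite !map_char_poly !map_adjmx; apply: eq_poly_horner => x.
by have := eqphi x 0; rewrite !phiE !scale0r !addr0.
Qed.

(** The values [t = 0] and [t = -1] give the two hypotheses of [walk_counts_eq], the all-ones matrix
    being [u *m v]. *)
Lemma phi_eq_walk_counts (R : numDomainType) n (G H : loopgraph n) k :
  (forall x t : R, phi G x t = phi H x t) ->
  (const_mx 1 : 'rV_n) *m adjmx int G ^+ k *m (const_mx 1 : 'cV_n) =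
  (const_mx 1 : 'rV_n) *m adjmx int H ^+ k *m (const_mx 1 : 'cV_n).
Proof.
move=> eqphi; pose u := const_mx 1 : 'cV[R]_n; pose v := const_mx 1 : 'rV[R]_n.
have uv : u *m v = const_mx 1.
  by apply/matrixP=> i j; rewrite !mxE big_ord1 !mxE mulr1.
have iterE (M : 'M[R]_n) : iter k (mulmx M) u = M ^+ k *m u.
  by elim: k => [|j IH]; rewrite ?expr0 ?mul1mx //= IH exprS mulmxA.
have intr_inj_mx : injective (map_mx (intr : int -> R) : 'M_1 -> 'M_1).
  by move=> M N /matrixP e; apply/matrixP=> i j; have := e i j; rewrite !mxE => /intr_inj.
apply: intr_inj_mx; rewrite !map_mxM !rmorphXn /= !map_adjmx !map_const_mx rmorph1.
rewrite -/u -/v -!mulmxA -!iterE; apply: walk_counts_eq; apply: eq_poly_horner => x.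
  by have := eqphi x 0; rewrite !phiE !scale0r !addr0.
by have := eqphi x (-1); rewrite !phiE !scaleN1r uv.
Qed.

Lemma walk_gram_eq (R : numDomainType) n (G H : loopgraph n) :
  (forall x t : R, phi G x t = phi H x t) ->
  (walkmx G)^T *m walkmx G = (walkmx H)^T *m walkmx H.
Proof.
move=> eqphi; rewrite !walkmx_gram; apply/matrixP=> i j.
by rewrite [LHS]mxE [RHS]mxE (phi_eq_walk_counts (i + j) eqphi).
Qed.

(** * Integrality of the quotient and the resulting permutation *)

Lemma mulmx_cancelr (R : idomainType) m n (V : 'M[R]_n) (X Y : 'M_(m, n)) :
  \det V != 0 -> X *m V = Y *m V -> X = Y.
Proof.
move=> nzd /(congr1 (mulmx^~ (\adj V))); rewrite -!mulmxA mul_mx_adj !mul_mx_scalar.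
by move/matrixP=> e; apply/matrixP=> i j; apply: (mulfI nzd); have := e i j; rewrite !mxE.
Qed.

(** The quotient is [W *m \adj V] divided by [\det V]; as [\det V] inherits square-freeness,
    divisibility is checked one prime at a time. *)
Lemma walkmx_integral_quotient n (G H : loopgraph n.+1) :
    char_poly (adjmx int G) = char_poly (adjmx int H) ->
    (walkmx G)^T *m walkmx G = (walkmx H)^T *m walkmx H ->
    squarefreez (\det (walkmx G)) ->
  \det (walkmx H) != 0 /\ exists P, P *m walkmx H = walkmx G.
Proof.
move=> eqchar eqgram sqfG; set W := walkmx G; set V := walkmx H.
have detWV : \det W = \det V \/ \det W = - \det V.
  have := congr1 determinant eqgram; rewrite !det_mulmx !det_tr -!expr2 => /eqP.
  by rewrite eqf_sqr => /orP[]/eqP; [left|right].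
have sqfH : squarefreez (\det V).
  by move=> p p_pr; have := sqfG p p_pr; rewrite -/W; case: detWV => ->; rewrite !dvdzE ?abszN.
have nzV : \det V != 0.
  by apply: contraTneq (sqfH 2%N isT) => ->; rewrite dvdz0.
split=> //.
have dvdN i j : (\det V %| (W *m \adj V) i j)%Z.
  apply: dvdz_squarefree => // p p_pr pV; rewrite (dvdz_Fp p_pr).
  have : map_mx (intr : int -> 'F_p) (W *m \adj V) = 0; last first.
    by move/matrixP/(_ i j); rewrite !mxE => ->.
  apply/matrixP=> a b; rewrite map_mxM; set M := map_mx _ (\adj V).
  have -> : (map_mx intr W *m M) a b = (map_mx intr W *m col b M) a 0.
    by rewrite colE mulmxA -colE [RHS]mxE.
  (* For [p] dividing [\det V], the columns of [\adj V] lie in the kernel of [V] modulo [p], hence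
     in that of [W]. *)
  rewrite (walk_kernel_sub p_pr (adjmx_tr int G) (adjmx_walkmx G) _ eqgram) ?mxE //.
  - by exists (adjmx int H); rewrite eqchar adjmx_walkmx.
  - by move=> c z; rewrite map_companion; exact: companion_eigenvector_eq0.
  - exact: sqfG.
  - exact: sqfH.
  rewrite colE mulmxA -colE -map_mxM mul_mx_adj map_scalar_mx /=.
  by move: pV; rewrite (dvdz_Fp p_pr) => /eqP->; rewrite raddf0 col0.
exists (\matrix_(i, j) ((W *m \adj V) i j %/ \det V)%Z).
set P := \matrix_(_, _) _.
have PV : P *m (\det V)%:M = W *m \adj V.
  by apply/matrixP=> i j; rewrite mul_mx_scalar [LHS]mxE mxE mulrC divzK.
have nzadj : \det (\adj V) != 0.
  apply: contraNneq nzV => nz; have/esym/eqP := congr1 determinant (mul_mx_adj V).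
  by rewrite det_mulmx nz mulr0 det_scalar expf_eq0 => /andP[].
by apply: (mulmx_cancelr nzadj); rewrite -mulmxA mul_mx_adj.
Qed.

(** [P] is orthogonal by the Gram identity, fixes the all-ones vector (column 0 of both walk
    matrices), and intertwines the adjacency matrices through their common companion matrix. It is
    therefore a permutation matrix carrying one graph to the other. *)
Lemma walkmx_conj_perm n (G H : loopgraph n.+1) (P : 'M[int]_n.+1) :
    char_poly (adjmx int G) = char_poly (adjmx int H) ->
    (walkmx G)^T *m walkmx G = (walkmx H)^T *m walkmx H ->
    \det (walkmx H) != 0 -> P *m walkmx H = walkmx G ->
  isomorphic G H.
Proof.
move=> eqchar eqgram nzV PV.
have PtP : P^T *m P = 1%:M.
  (* Multiplying by [walkmx H] on the right and its transpose on the left reduces the claim to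
     [eqgram]. *)
  apply: (mulmx_cancelr nzV); apply: trmx_inj.
  rewrite mul1mx; apply: (mulmx_cancelr nzV).
  by rewrite -eqgram -PV !trmx_mul !trmxK !mulmxA.
have Pe : P *m (const_mx 1 : 'cV_n.+1) = const_mx 1.
  have col0 (K : loopgraph n.+1) : col 0 (walkmx K) = const_mx 1.
    by apply/matrixP=> i j; rewrite mxE mxE expr0 mul1mx mxE [RHS]mxE.
  by rewrite -{1}(col0 H) colE mulmxA -colE PV col0.
have AP : adjmx int G *m P = P *m adjmx int H.
  apply: (mulmx_cancelr nzV); rewrite -!mulmxA PV !adjmx_walkmx eqchar mulmxA.
  by rewrite PV.
have PPt := mulmx1C PtP.
have [f [injf defP]] := int_orthogonal_perm PPt Pe.
exists f; first exact: injF_bij.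
move=> i j; have AE : adjmx int G = P *m adjmx int H *m P^T.
  by rewrite -AP -mulmxA PPt mulmx1.
have/matrixP/(_ i j) := AE.
have mulPE (M : 'M[int]_n.+1) k l : (P *m M) k l = M (f k) l.
  rewrite mxE (bigD1 (f k)) //= defP mxE eqxx mul1r big1 ?addr0 // => k' nk.
  by rewrite mxE (negPf nk) mul0r.
have mulPtE (M : 'M[int]_n.+1) k l : (M *m P^T) k l = M k (f l).
  by rewrite -[M]trmxK -trmx_mul mxE mulPE !mxE.
rewrite mulPtE mulPE !mxE.
by case: (adj G i j); case: (adj H _ _).
Qed.

Lemma isomorphic_sym n m (G : loopgraph n) (H : loopgraph m) :
  isomorphic G H -> isomorphic H G.
Proof.
case=> f [g fK gK] fadj; exists g; first by exists f.
by move=> i j; rewrite -fadj !gK.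
Qed.

Theorem theorem1p2 (R : realType) (n : nat) (G : loopgraph n)
    (sqf_detW : squarefreez (\det (walkmx G))) :
  forall (m : nat) (H : loopgraph m),
    (forall lambda t : R, phi G lambda t = phi H lambda t) ->
    isomorphic H G.
Proof.
move=> m H eqphi; have eqnm := phi_eq_size eqphi; case: m / eqnm H eqphi => H eqphi.
(* The companion matrix requires a positive size, so the graph without vertices is treated apart. *)
case: n G sqf_detW H eqphi => [|n] G sqfG H eqphi.
  by exists id; [exists id | case].
have eqchar := phi_eq_char_poly eqphi; have eqgram := walk_gram_eq eqphi.
have [nzV [P PV]] := walkmx_integral_quotient eqchar eqgram sqfG.
exact/isomorphic_sym/(walkmx_conj_perm eqchar eqgram nzV PV).
Qed.
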